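(* Let $X$ and $Y$ be compact Hausdorff spaces. Let $T\colon C(X)\to C(Y)$ be a bijective map that satisfies the following equalities for all $f,g\in C(X)$: \[ \Vert T(f+g)\Vert=\Vert T(f)+T(g)\Vert,\qquad \Vert T(fg)\Vert=\Vert T(f)T(g)\Vert,\qquad T(\overline{f})=\overline{T(f)}. \] Then there exist a function $u\in C_{\mathbb{R}}(Y)$ with $u(Y)\subset\{\pm1\}$, a homeomorphism $\tau\colon Y\to X$ and a closed and open subset $K$ of $Y$ such that for all $f\in C(X)$ and $y\in Y$: \[ T(f)(y)= \begin{cases} u(y)f(\tau(y)) & \text{if } y\in K,\\ u(y)\overline{f(\tau(y))} & \text{if } y\in Y\setminus K. \end{cases} \]
   Context: For a compact Hausdorff space $X$, $C(X)$ denotes the commutative Banach algebra of all continuous complex-valued functions on $X$ with pointwise operations and the supremum norm $\Vert\cdot\Vert$, and $C_{\mathbb{R}}(X)$ denotes the set of all continuous real-valued functions on $X$. The function $\overline{g}$ is the pointwise complex conjugate of $g$. The map $T$ is not assumed to be linear, additive, multiplicative or continuous. *)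

(* Defs.v *)
From HB Require Import structures.
From mathcomp Require Import all_boot all_order all_algebra.
From mathcomp Require Import complex.
From mathcomp Require Import all_classical all_reals all_analysis.
Set Implicit Arguments.
Unset Strict Implicit.
Unset Printing Implicit Defensive.
Import Order.TTheory GRing.Theory Num.Theory.
Import numFieldNormedType.Exports.
Local Open Scope classical_set_scope.
Local Open Scope ring_scope.

(* The cast to numFieldType puts the norm topology on R[i]: a basic            *)
(* neighbourhood of z is {w | `|z - w| < e} with 0 < e in R[i], and 0 < e      *)
(* in R[i] forces e to be real.                                                *)
Definition contC (R : realType) (X : topologicalType) : Type :=
  continuousType X (R[i] : numFieldType).

Section ContC.
Context {R : realType} {X : topologicalType}.
Implicit Types f g h : contC R X.

HB.instance Definition _ := Choice.copy (contC R X)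
  (continuousType X (R[i] : numFieldType)).

Lemma contC_eqP f g : (forall x, f x = g x) -> f = g.
Proof. by move=> fg; apply/continuousEP. Qed.

Fact contC_zero_cts :
  continuous ((fun=> 0) : X -> (R[i] : numFieldType)).
Proof. by move=> x; exact: cvg_cst. Qed.

Fact contC_one_cts :
  continuous ((fun=> 1) : X -> (R[i] : numFieldType)).
Proof. by move=> x; exact: cvg_cst. Qed.

Fact contC_opp_cts f :
  continuous ((fun x => - f x) : X -> (R[i] : numFieldType)).
Proof. by move=> x; exact: (continuousN (@cts_fun _ _ f x)). Qed.

Fact contC_add_cts f g :
  continuous ((fun x => f x + g x) : X -> (R[i] : numFieldType)).
Proof.
by move=> x; exact: (continuousD (@cts_fun _ _ f x) (@cts_fun _ _ g x)).
Qed.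

Fact contC_mul_cts f g :
  continuous ((fun x => f x * g x) : X -> (R[i] : numFieldType)).
Proof.
by move=> x; exact: (continuousM (@cts_fun _ _ f x) (@cts_fun _ _ g x)).
Qed.

Fact contC_conj_cts f :
  continuous ((fun x => conjc (f x)) : X -> (R[i] : numFieldType)).
Proof.
move=> x; apply/cvgrPdist_lt => e e0.
have /cvgrPdist_lt/(_ e e0) := @cts_fun _ _ f x.
by apply: filterS => y; rewrite -rmorphB /= normcJ.
Qed.

Definition contC_zero : contC R X := mkcts contC_zero_cts.
Definition contC_one : contC R X := mkcts contC_one_cts.
Definition contC_opp f : contC R X := mkcts (@contC_opp_cts f).
Definition contC_add f g : contC R X := mkcts (@contC_add_cts f g).
Definition contC_mul f g : contC R X := mkcts (@contC_mul_cts f g).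
Definition contC_conj f : contC R X := mkcts (@contC_conj_cts f).

Fact contC_addA : associative contC_add.
Proof. by move=> f g h; apply: contC_eqP => x; exact: addrA. Qed.

Fact contC_addC : commutative contC_add.
Proof. by move=> f g; apply: contC_eqP => x; exact: addrC. Qed.

Fact contC_add0 : left_id contC_zero contC_add.
Proof. by move=> f; apply: contC_eqP => x; exact: add0r. Qed.

Fact contC_addN : left_inverse contC_zero contC_opp contC_add.
Proof. by move=> f; apply: contC_eqP => x; exact: addNr. Qed.

HB.instance Definition _ := GRing.isZmodule.Build (contC R X)
  contC_addA contC_addC contC_add0 contC_addN.

Fact contC_mulA : associative contC_mul.
Proof. by move=> f g h; apply: contC_eqP => x; exact: mulrA. Qed.

Fact contC_mulC : commutative contC_mul.
Proof. by move=> f g; apply: contC_eqP => x; exact: mulrC. Qed.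

Fact contC_mul1 : left_id contC_one contC_mul.
Proof. by move=> f; apply: contC_eqP => x; exact: mul1r. Qed.

Fact contC_mulDl : left_distributive contC_mul contC_add.
Proof. by move=> f g h; apply: contC_eqP => x; exact: mulrDl. Qed.

(* Only a pzRing (0 = 1 allowed), since X may be empty. *)
HB.instance Definition _ := GRing.Zmodule_isComPzRing.Build (contC R X)
  contC_mulA contC_mulC contC_mul1 contC_mulDl.

(* For compact X the set of values is bounded above, so sup is the true        *)
(* supremum; for empty X it is sup set0 = 0.                                   *)
Definition supnorm f : R := sup [set Normc.normc (f x) | x in [set: X]].

End ContC.

Definition homeomorphism (X Y : topologicalType) (tau : X -> Y) : Prop :=
  continuous tau /\
  exists sigma : Y -> X,
    [/\ continuous sigma, cancel tau sigma & cancel sigma tau].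

(* Main.v *)
Require Import Defs.
From HB Require Import structures.
From mathcomp Require Import all_boot all_order all_algebra.
From mathcomp Require Import complex.
From mathcomp Require Import all_classical all_reals all_analysis.
From mathcomp Require Import ring lra.
Import Order.TTheory GRing.Theory Num.Theory.
Import numFieldNormedType.Exports.
Local Open Scope classical_set_scope.
Local Open Scope ring_scope.
Local Open Scope complex_scope.

(** Additivity and multiplicativity of [T] are recovered from the two norm
equalities, after which [T] is, up to a sign, an isomorphism of rings with
involution, and such an isomorphism is composition with a homeomorphism.

Additivity.  The function f |-> ||T f|| is a norm on the group C(X) which
doubles when f is doubled, and [T] is an isometry from it onto C(Y).  The
reflection proof of the Mazur-Ulam theorem uses nothing else: [T] preserves
midpoints, and [T 0 = 0], so [T] is additive ([norm_additive_additive]).  No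
real homogeneity is available at this stage.

Normalization.  Put e = T 1.  Since ||e T f|| = ||T f|| and [T] is onto, |e| = 1
everywhere; as e is real, e takes only the values 1 and -1.  Then S = e T is
additive and unital and keeps the multiplicative norm equality.

Multiplicativity.  For all k,
||S (f g) S k|| = ||S f S (g k)|| <= ||S f|| ||S g S k||.  Since S k is arbitrary,
it can be chosen concentrated near a point, which gives the pointwise bound
|S (f g) (y)| <= ||S f|| |S g (y)| ([ideal_bound]).  Hence S (f g) (y) depends only
on S g (y), through an additive and bounded, therefore real-linear, map of the
complex plane.  Applied to the constant i, the bound gives S i (y) = i or -i, and
two real-linear maps that agree at 1 and at i are equal; comparing
S (f g) (y) with S f (y) S g (y) at these two values makes [S] multiplicative
([supnorm_multiplicative_multiplicative]).

Representation.  For each y the kernel of f |-> S f (y) is a proper ideal, so by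
compactness its elements have a common zero tau(y).  On constants, f |-> S f (y)
is an endomorphism of the complex field commuting with conjugation, hence the
identity or the conjugation.  Together these give S f (y) = f (tau y) or its
conjugate ([star_rmorphism_point]).  Urysohn functions make tau continuous, and
the same construction for the inverse of [S] gives the inverse of tau. *)

(** * The Mazur-Ulam theorem for normed groups *)

Section MazurUlam.
Context {R : realType}.

Lemma archi_le0 (a B : R) : (forall n : nat, n%:R * a <= B) -> a <= 0.
Proof.
move=> aB; rewrite leNgt; apply/negP => a0.
have := aB (Num.truncn (B / a)).+1.
by apply/negP; rewrite -ltNge -ltr_pdivrMr// truncnS_gt.
Qed.

(** The part of the norm axioms that makes sense on an abelian group and that the
reflection argument needs: [N (x + x) = 2 * N x] stands in for homogeneity. *)
Definition doubling_norm (V : zmodType) (N : V -> R) : Prop :=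
  [/\ forall x y, N (x + y) <= N x + N y, forall x, N (- x) = N x,
      forall x, N (x + x) = 2 * N x & forall x, N x = 0 -> x = 0].

Lemma doubling_norm_ge0 (V : zmodType) (N : V -> R) x :
  doubling_norm V N -> 0 <= N x.
Proof.
move=> [tri opp dbl _].
have N0 : N 0 = 0 by have := dbl 0; rewrite addr0; lra.
by have := tri x (- x); rewrite subrr N0 opp; lra.
Qed.

(** The point reflection with centre half of [s], written without halving. *)
Definition reflection (V : zmodType) (s x : V) : V := s - x.

Lemma reflectionK (V : zmodType) (s : V) : involutive (reflection V s).
Proof. by move=> x; rewrite /reflection opprB addrC subrK. Qed.

Lemma reflection_midpoint (V : zmodType) (s z : V) :
  z + z = s -> reflection V s z = z.
Proof. by move=> <-; rewrite /reflection addrK. Qed.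

Lemma reflection_addl (V : zmodType) (a b : V) : reflection V (a + b) a = b.
Proof. by rewrite /reflection addrAC subrr add0r. Qed.

Lemma reflection_addr (V : zmodType) (a b : V) : reflection V (a + b) b = a.
Proof. by rewrite /reflection addrK. Qed.

Lemma reflectionB (V : zmodType) (s x y : V) :
  reflection V s x - reflection V s y = - (x - y).
Proof. by rewrite /reflection opprB addrC addrA subrK opprB. Qed.

(** Composing [g] with its inverse conjugated by the reflection exchanging [a] and
[b] gives another isometry fixing [a] and [b], which moves the midpoint [z] twice
as far.  Since every such isometry moves [z] by at most twice the distance from
[z] to [a], iterating forces the displacement to vanish. *)
Lemma isometry_fixes_midpoint (V : zmodType) (N : V -> R) (a b z : V)
    (g g' : V -> V) :
  doubling_norm V N -> z + z = a + b ->
  cancel g g' -> cancel g' g -> (forall x y, N (g x - g y) = N (x - y)) ->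
  g a = a -> g b = b -> g z = z.
Proof.
move=> HN zab gK g'K giso ga gb.
have [tri opp dbl sep] := HN.
suff bound n : forall h h' : V -> V, cancel h h' -> cancel h' h ->
    (forall x y, N (h x - h y) = N (x - y)) -> h a = a -> h b = b ->
    2 ^+ n * N (h z - z) <= 2 * N (z - a).
  have gz0 : N (g z - z) <= 0.
    apply: (@archi_le0 _ (2 * N (z - a))) => n.
    apply: le_trans (bound n _ _ gK g'K giso ga gb).
    apply: ler_wpM2r; first exact: doubling_norm_ge0.
    by rewrite -natrX ler_nat ltnW// ltn_expl.
  apply/eqP; rewrite -subr_eq0; apply/eqP/sep/eqP.
  by rewrite eq_le gz0 doubling_norm_ge0.
elim: n => [|n IHn] h h' hK h'K hiso ha hb.
  rewrite expr0 mul1r.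
  have -> : h z - z = (h z - h a) + (a - z) by rewrite ha addrA subrK.
  by apply: le_trans (tri _ _) _; rewrite hiso -(opp (a - z)) opprB; lra.
have h'iso x y : N (h' x - h' y) = N (x - y) by rewrite -hiso !h'K.
have h'a : h' a = a by rewrite -{1}ha hK.
have h'b : h' b = b by rewrite -{1}hb hK.
have rz := reflection_midpoint V (a + b) z zab.
have rab := reflection_addl V a b; have rba := reflection_addr V a b.
have rK := reflectionK V (a + b).
have riso x y : N (reflection V (a + b) x - reflection V (a + b) y) = N (x - y).
  by rewrite reflectionB opp.
pose r := reflection V (a + b).
have := IHn (r \o h' \o r \o h) (h' \o r \o h \o r).
have -> : N ((r \o h' \o r \o h) z - z) = 2 * N (h z - z).
  rewrite /= /r -{2}rz riso -{2}(hK z) h'iso /r /reflection -zab.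
  have -> : z + z - h z - h z = (z - h z) + (z - h z).
    by rewrite -addrA addrACA.
  by rewrite dbl -opp opprB.
rewrite exprSr -mulrA; apply.
- by move=> x /=; rewrite /r rK h'K rK hK.
- by move=> x /=; rewrite /r h'K rK hK rK.
- by move=> x y; rewrite /= /r riso h'iso riso hiso.
- by rewrite /= /r ha rab h'b rba.
- by rewrite /= /r hb rba h'a rab.
Qed.

(** The norm of [W] pulls back along [T] to [V], and [T] becomes an isometry.  Conjugating by
[T] the reflection exchanging [T a] and [T b], and following it with the
reflection exchanging [a] and [b], gives an isometry fixing [a] and [b], hence
their midpoint: [T] preserves midpoints. *)
Lemma norm_additive_additive (V W : zmodType) (M : W -> R) (T : V -> W) :
  doubling_norm W M -> bijective T ->
  (forall f g, M (T (f + g)) = M (T f + T g)) -> {morph T : f g / f + g}.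
Proof.
move=> HM [T' TK T'K] Tadd; have [tri opp dbl sep] := HM.
have M0 : M 0 = 0 by have := dbl 0; rewrite addr0; lra.
have T0 : T 0 = 0.
  apply: sep; have := Tadd 0 0; rewrite addr0 dbl.
  lra.
have TN f : T (- f) = - T f.
  apply/eqP; rewrite -addr_eq0; apply/eqP/sep.
  by rewrite -Tadd addNr T0.
have TB f g : M (T (f - g)) = M (T f - T g) by rewrite Tadd TN.
pose N f := M (T f).
have HN : doubling_norm V N.
  split=> [f g|f|f|f]; rewrite /N.
  - by rewrite Tadd.
  - by rewrite TN.
  - by rewrite Tadd.
  - by move/sep => Tf0; rewrite -(TK f) Tf0 -T0 TK.
have mid a b z : z + z = a + b -> T z + T z = T a + T b.
  move=> zab.
  have rz := reflection_midpoint V (a + b) z zab.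
  have rK := reflectionK V (a + b).
  have r'K := reflectionK W (T a + T b).
  have : (reflection V (a + b) \o T' \o reflection W (T a + T b) \o T) z = z.
    apply: (isometry_fixes_midpoint V N a b z _
      (T' \o reflection W (T a + T b) \o T \o reflection V (a + b))) => //.
    - by move=> x; rewrite /= rK T'K r'K TK.
    - by move=> x; rewrite /= T'K r'K TK rK.
    - move=> x y.
      by rewrite /N /= reflectionB TN opp TB !T'K reflectionB opp TB.
    - by rewrite /= reflection_addl TK reflection_addr.
    - by rewrite /= reflection_addr TK reflection_addl.
  move=> /(congr1 (reflection V (a + b))); rewrite /= rK rz.
  move=> /(congr1 T); rewrite T'K.
  by rewrite /reflection => /eqP; rewrite subr_eq => /eqP.
have Tdbl f : T (f + f) = T f + T f.
  by rewrite (mid (f + f) 0 f) ?addr0// T0 addr0.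
move=> f g; apply/eqP; rewrite -subr_eq0; apply/eqP/sep.
suff : M ((T (f + g) - (T f + T g)) + (T (f + g) - (T f + T g))) = 0.
  by rewrite dbl; lra.
(* [f + g] is the midpoint of [f + f] and [g + g]. *)
have mfg := mid (f + f) (g + g) (f + g) (addrACA f g f g).
by rewrite addrACA -opprD mfg !Tdbl [X in _ - X]addrACA subrr.
Qed.

End MazurUlam.

(** * The modulus and real-linear maps of the complex plane *)

Section ComplexModulus.
Context {R : realType}.
Implicit Types (z w : R[i]).
Local Notation normc := (@Normc.normc R).
Local Notation Re := (@complex.Re R).
Local Notation Im := (@complex.Im R).

Lemma normcD z w : normc (z + w) <= normc z + normc w.
Proof. exact: (@le_normcD R). Qed.

Lemma normcN z : normc (- z) = normc z.
Proof. exact: (@complex.normcN R). Qed.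

Lemma normc_ge0 z : 0 <= normc z.
Proof. by case: z => a b; exact: sqrtr_ge0. Qed.

Lemma normr_normc z : `|z| = (normc z)%:C.
Proof. by []. Qed.

Lemma normc_real (r : R) : normc r%:C = `|r|.
Proof. by rewrite /= expr0n /= addr0 sqrtr_sqr. Qed.

Lemma ler_dist_normc z w : `|normc z - normc w| <= normc (z - w).
Proof.
have h a b : normc a - normc b <= normc (a - b).
  by rewrite lerBlDr -{1}(subrK b a) normcD.
by rewrite ler_norml h andbT lerNl opprB -(normcN (z - w)) opprB h.
Qed.

Lemma ler_norm_Re z : `|Re z| <= normc z.
Proof.
case: z => a b /=; rewrite -sqrtr_sqr; apply: ler_wsqrtr.
by rewrite lerDl sqr_ge0.
Qed.

(** The radii of balls in [R[i]] are complex, so continuity towards [R] is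
obtained by comparing moduli. *)
Lemma continuous_complex_lipschitz (phi : (R[i] : numFieldType) -> R) :
  (forall z w, `|phi z - phi w| <= normc (z - w)) -> continuous phi.
Proof.
move=> lip z; apply: (iffRL (@cvgrPdist_lt _ _ _ (nbhs z) (nbhs_filter z) _ _)).
move=> e e0.
have e0' : 0 < e%:C by rewrite ltcR.
have := @nbhsx_ballx (R[i] : numFieldType) (R[i] : numFieldType) z _ e0'.
apply: filterS => w; rewrite /ball /= normr_normc ltcR; exact: le_lt_trans.
Qed.

Lemma continuous_real_complex :
  continuous ((fun r : R => r%:C) : R -> (R[i] : numFieldType)).
Proof.
move=> r; apply/cvgrPdist_lt => -[a b]; rewrite ltcE /= => /andP[/eqP -> e0].
have /cvgrPdist_lt/(_ a e0) : id x @[x --> r] --> r by exact: cvg_id.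
apply: filterS => s; rewrite -rmorphB normr_normc normc_real.
by rewrite ltcE /= eqxx.
Qed.

(** The defect [phi (r z) - r (phi z)] is additive in [r], vanishes at integers
and is bounded for [r] in the unit interval; multiplying [r] by [n] and removing
the integer part shows that [n] times the defect stays bounded. *)
Lemma bounded_additive_real_homogeneous (phi : {additive R[i] -> R[i]}) (C : R) :
  (forall z, normc (phi z) <= C * normc z) ->
  forall (r : R) z, phi (r%:C * z) = r%:C * phi z.
Proof.
move=> phiC r z; apply/eqP; rewrite -subr_eq0; apply/eqP/Normc.eq0_normc/eqP.
rewrite eq_le normc_ge0 andbT.
apply: (@archi_le0 _ _ (C * normc z + normc (phi z))) => n.
pose m := Num.floor (n%:R * r); pose s := n%:R * r - m%:~R.
have s01 : `|s| <= 1.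
  rewrite /s; have /andP[] := mem_rg1_floor (n%:R * r).
  by rewrite ler_norml -/m; lra.
have nE : (n%:R)%:C = n%:R :> R[i] by rewrite rmorph_nat.
have mE : (m%:~R)%:C = m%:~R :> R[i] by rewrite rmorph_int.
have -> : n%:R * normc (phi (r%:C * z) - r%:C * phi z) =
          normc (phi (s%:C * z) - s%:C * phi z).
  rewrite -[X in X * _](ger0_norm (ler0n R n)) -normc_real -Normc.normcM nE.
  have phin : phi (n%:R * (r%:C * z)) = n%:R * phi (r%:C * z).
    by rewrite !mulr_natl raddfMn.
  have phim : phi (m%:~R * z) = m%:~R * phi z by rewrite !mulrzl raddfMz.
  congr normc; rewrite /s rmorphB rmorphM /= nE mE.
  by rewrite mulrBl raddfB -mulrA phin phim; ring.
apply: le_trans (normcD _ _) _; rewrite normcN Normc.normcM normc_real.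
apply: lerD.
  apply: le_trans (phiC _) _; rewrite Normc.normcM normc_real.
  have C0 : 0 <= C * normc z by apply: le_trans (phiC z); exact: normc_ge0.
  by rewrite mulrCA ler_piMl.
by rewrite ler_piMl// normc_ge0.
Qed.

Lemma real_linear_complexE (phi : R[i] -> R[i]) (c j : R[i]) :
  {morph phi : z w / z + w} ->
  (forall (r : R) z, phi (r%:C * z) = r%:C * phi z) ->
  j = 'i \/ j = - 'i -> phi 1 = c -> phi j = j * c ->
  forall z, phi z = z * c.
Proof.
move=> phiD phiZ ij phi1 phij z.
have phii : phi 'i = 'i * c.
  case: ij phij => -> //.
  have := phiZ (-1) 'i; rewrite rmorphN1 !mulN1r => ->.
  by rewrite mulNr => /oppr_inj.
rewrite [z in LHS]complexE phiD [in 'i * _]mulrC phiZ phii.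
rewrite -[in X in phi X](mulr1 (Re z)%:C) phiZ phi1.
rewrite [RHS](congr1 ( *%R^~ c) (complexE z)).
by rewrite mulrDl mulrCA mulrA.
Qed.

End ComplexModulus.

(** * The supremum norm *)

Section SupNorm.
Context {R : realType} {X : topologicalType}.
Implicit Types f g h : contC R X.
Local Notation normc := (@Normc.normc R).

Lemma continuous_normc f : continuous (fun x => normc (f x) : R).
Proof.
move=> x; apply: (@continuous_comp _ _ _ f (normc : (R[i] : numFieldType) -> R)).
  exact: (@cts_fun _ _ f x).
by apply: continuous_complex_lipschitz => z w; exact: ler_dist_normc.
Qed.

Lemma supnorm_le f (c : R) :
  0 <= c -> (forall x, normc (f x) <= c) -> supnorm f <= c.
Proof.
move=> c0 fc; rewrite /supnorm.
set E := (X in sup X).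
have [->|/set0P[r Er]] := eqVneq E set0; first by rewrite sup0.
by apply: ge_sup; [exists r|move=> _ [x _ <-]].
Qed.

Lemma supnorm_ge (cX : compact [set: X]) f x : normc (f x) <= supnorm f.
Proof.
apply: ub_le_sup; last by exists x.
have : compact ((fun x => normc (f x) : R^o) @` [set: X]).
  apply: continuous_compact => //; apply: continuous_subspaceT.
  exact: continuous_normc.
move=> /compact_bounded [M [_ HM]]; exists (M + 1) => _ [y _ <-].
have M1 : M < M + 1 by rewrite ltrDl.
by have := HM _ M1 _ (ex_intro2 _ _ y I erefl); exact/le_trans/ler_norm.
Qed.

Lemma supnorm_ge0 (cX : compact [set: X]) f : 0 <= supnorm f.
Proof.
have [[x _]|X0] := pselect ([set: X] !=set0).
  by apply: le_trans (supnorm_ge cX f x); exact: normc_ge0.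
rewrite /supnorm (_ : image _ _ = set0) ?sup0// -subset0 => r [x _ _].
by apply: X0; exists x.
Qed.

(** This lets the Mazur-Ulam argument be applied with values in C(Y). *)
Lemma supnorm_doubling (cX : compact [set: X]) :
  doubling_norm (contC R X) (@supnorm R X).
Proof.
have s0 := supnorm_ge0 cX.
have tri f g : supnorm (f + g) <= supnorm f + supnorm g.
  apply: supnorm_le => [|x]; first by rewrite addr_ge0.
  apply: le_trans (normcD (f x) (g x)) _.
  by apply: lerD; exact: supnorm_ge.
split=> // [f|f|f f0].
- suff h g : supnorm (- g) <= supnorm g.
    by apply/eqP; rewrite eq_le h -{1}(opprK f) h.
  apply: supnorm_le => // x.
  by rewrite -[X in normc X]/(- g x) normcN supnorm_ge.
- apply/eqP; rewrite eq_le; apply/andP; split.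
    by apply: le_trans (tri _ _) _; lra.
  rewrite -ler_pdivlMl//; apply: supnorm_le => [|x].
    by rewrite mulr_ge0// invr_ge0.
  rewrite ler_pdivlMl//; apply: le_trans (supnorm_ge cX _ x).
  rewrite -[X in _ <= normc X]/(f x + f x) -mulr2n.
  by rewrite (@complex.normcMn R) mulr_natl.
- apply: contC_eqP => x; apply: Normc.eq0_normc; apply/eqP.
  by rewrite eq_le normc_ge0 -f0 supnorm_ge.
Qed.

Lemma supnormM_le (cX : compact [set: X]) f g :
  supnorm (f * g) <= supnorm f * supnorm g.
Proof.
have s0 := supnorm_ge0 cX.
apply: supnorm_le => [|x]; first by rewrite mulr_ge0.
rewrite -[X in normc X]/(f x * g x) Normc.normcM.
by apply: ler_pM; rewrite ?normc_ge0// supnorm_ge.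
Qed.

Fact contC_const_cts (z : R[i]) :
  continuous ((fun=> z) : X -> (R[i] : numFieldType)).
Proof. by move=> x; exact: cvg_cst. Qed.

Definition contC_const z : contC R X := mkcts (contC_const_cts z).

(** The function [1 / (e + |g|)] is largest where [g] is smallest, and its product
with [g] has norm at most 1; it plays the role of a peak function adapted to [g],
without recourse to Urysohn functions. *)
Fact peak_cts g (e : R) (e0 : 0 < e) :
  continuous ((fun x => ((e + normc (g x))^-1)%:C) : X -> (R[i] : numFieldType)).
Proof.
move=> x; apply: (@continuous_comp _ _ _ (fun x => (e + normc (g x))^-1 : R)
  (fun r : R => r%:C : (R[i] : numFieldType))); last exact: continuous_real_complex.
apply: cvgV.
  by rewrite gt_eqF// ltr_pwDl// normc_ge0.
by apply: cvgD; [exact: cvg_cst|exact: continuous_normc].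
Qed.

(** Testing against [h = 1 / (d + |g|)] gives [|f x| / (d + |g x|) <= c], and [d]
is arbitrarily small. *)
Lemma supnorm_mul_dominates (cX : compact [set: X]) f g (c : R) :
  0 <= c -> (forall h, supnorm (f * h) <= c * supnorm (g * h)) ->
  forall x, normc (f x) <= c * normc (g x).
Proof.
move=> c0 fg x; apply/ler_addgt0Pr => e e0.
(* The factor [c + 1] avoids a division by zero and still gives [c * d <= e]. *)
have d0 : 0 < e / (c + 1) by rewrite divr_gt0// ltr_wpDl.
set d := e / (c + 1) in d0.
have dn y : 0 < d + normc (g y) by rewrite ltr_pwDl// normc_ge0.
have ndn y : normc ((d + normc (g y))^-1)%:C = (d + normc (g y))^-1.
  by rewrite normc_real ger0_norm// invr_ge0 ltW.
pose h : contC R X := mkcts (peak_cts g d d0).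
have gh : supnorm (g * h) <= 1.
  apply: supnorm_le => // y.
  rewrite -[X in normc X]/(g y * ((d + normc (g y))^-1)%:C).
  by rewrite Normc.normcM ndn ler_pdivrMr// mul1r lerDr ltW.
have fh : normc (f x) / (d + normc (g x)) <= c.
  apply: (@le_trans _ _ (supnorm (f * h))).
    apply: le_trans (supnorm_ge cX _ x).
    rewrite -[X in _ <= normc X]/(f x * ((d + normc (g x))^-1)%:C).
    by rewrite Normc.normcM ndn.
  by apply: le_trans (fg h) _; rewrite ler_piMr.
rewrite ler_pdivrMr// in fh; apply: le_trans fh _.
rewrite mulrDr addrC lerD2l /d mulrCA; apply: ler_piMr; first exact: ltW.
by rewrite ler_pdivrMr ?ltr_wpDl// mul1r lerDl.
Qed.

End SupNorm.

(** * From multiplicativity of the norm to multiplicativity *)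

Section Multiplicative.
Context {R : realType} {X Y : topologicalType}.
Local Notation normc := (@Normc.normc R).
Variables (cY : compact [set: Y]) (S : {additive contC R X -> contC R Y}).
Variable (S' : contC R Y -> contC R X).
Hypotheses (SK : cancel S S') (S'K : cancel S' S).
Hypothesis (S1 : S 1 = 1).
Hypothesis Sconj : forall f, S (contC_conj f) = contC_conj (S f).
Hypothesis Smul : forall f g, supnorm (S (f * g)) = supnorm (S f * S g).
Local Notation iX := (contC_const 'i : contC R X).

(** Every element of C(Y) is some [S k], and associativity moves [f] past [k]:
||S (f g) S k|| = ||S f S (g k)|| <= ||S f|| ||S g S k||. *)
Lemma ideal_bound f g y :
  normc (S (f * g) y) <= supnorm (S f) * normc (S g y).
Proof.
apply: supnorm_mul_dominates => // [|h]; first exact: supnorm_ge0.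
rewrite -(S'K h) -Smul -mulrA Smul.
by apply: le_trans (supnormM_le cY _ _) _; rewrite Smul.
Qed.

Lemma mul_iX : iX * iX = - 1.
Proof.
apply: contC_eqP => x; rewrite -[LHS]/('i * 'i) -[RHS]/(- 1 : R[i]).
by rewrite -expr2 sqr_i.
Qed.

(** The value is purely imaginary because [S] commutes with conjugation.  Its
modulus is at most 1 because ||(S i)(S i)|| = ||S (-1)|| = 1, and at least 1 because
1 = |S (i i) (y)| <= ||S i|| |S i (y)|. *)
Lemma image_of_i y : S iX y = 'i \/ S iX y = - 'i.
Proof.
have SN1 : S (iX * iX) = - 1 by rewrite mul_iX raddfN S1.
have N1y : normc (S (iX * iX) y) = 1.
  by rewrite SN1 -[X in normc X]/(- (1 : R[i])) normcN Normc.normc1.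
have Si1 : supnorm (S iX) <= 1.
  apply: supnorm_le => // z; rewrite -(@ler_pXn2r _ 2) ?nnegrE ?normc_ge0//.
  rewrite expr1n expr2 -Normc.normcM -[X in normc X]/((S iX * S iX) z).
  apply: le_trans (supnorm_ge cY _ _) _; rewrite -Smul SN1.
  apply: supnorm_le => // t.
  by rewrite -[X in normc X]/(- (1 : R[i])) normcN Normc.normc1.
have nS : normc (S iX y) = 1.
  apply/eqP; rewrite eq_le (le_trans (supnorm_ge cY _ _) Si1)/=.
  rewrite -[X in X <= _]N1y; apply: le_trans (ideal_bound _ _ _) _.
  by rewrite ler_piMl// normc_ge0.
have cS : conjc (S iX y) = - S iX y.
  rewrite -[LHS]/(contC_conj (S iX) y) -Sconj.
  rewrite (_ : contC_conj iX = - iX) ?raddfN//.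
  by apply: contC_eqP => x; rewrite -[RHS]/(Complex (- 0) (- 1)) oppr0.
move: nS cS; case: (S iX y) => a b /=.
move=> /(congr1 (fun r => r ^+ 2)); rewrite sqr_sqrtr ?addr_ge0 ?sqr_ge0//.
move=> ab [aN]; have a0 : a = 0 by lra.
move: ab; rewrite a0 expr0n add0r expr1n => /eqP; rewrite sqrf_eq1.
by move=> /orP[] /eqP ->; [left|right]; rewrite // -[RHS]/(Complex (- 0) (- 1)) oppr0.
Qed.

(** By [ideal_bound], [S (f * g) y] depends only on the number [S g y], additively
and boundedly. *)
Lemma mul_real_linear_in_image f y : exists phi : {additive R[i] -> R[i]},
  (forall (r : R) z, phi (r%:C * z) = r%:C * phi z) /\
  (forall g, S (f * g) y = phi (S g y)).
Proof.
pose phi z := S (f * S' (contC_const z)) y.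
have bnd g : S (f * g) y = phi (S g y).
  rewrite /phi; set h := S' _.
  apply/eqP; rewrite -subr_eq0; apply/eqP/Normc.eq0_normc/eqP.
  rewrite eq_le normc_ge0 andbT.
  rewrite -[X in normc X]/((S (f * g) - S (f * h)) y) -raddfB -mulrBr.
  apply: le_trans (ideal_bound _ _ _) _.
  rewrite raddfB /h S'K -[X in normc X]/(S g y - S g y) subrr.
  by rewrite Normc.normc0 mulr0.
have phiB : zmod_morphism phi.
  move=> z w; rewrite -[z - w]/((contC_const z - contC_const w : contC R Y) y).
  rewrite -(S'K (contC_const z)) -(S'K (contC_const w)) -raddfB -bnd.
  by rewrite mulrBr raddfB.
pose phiA : {additive R[i] -> R[i]} :=
  HB.pack phi (GRing.isZmodMorphism.Build _ _ phi phiB).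
exists phiA; split=> // r z.
apply: (@bounded_additive_real_homogeneous _ phiA (supnorm (S f))) => w.
by apply: le_trans (ideal_bound _ _ _) _; rewrite S'K.
Qed.

(** The real-linear map sending [S g y] to [S (f * g) y] is determined by its
values at [1] and at [S i y]; the first is [S f y], and the second is [S (f i) y].
The latter is found by applying the same reasoning with [i] in place of [f],
where the required value is [S (i * i) y = -1]. *)
Lemma supnorm_multiplicative_multiplicative : {morph S : f g / f * g}.
Proof.
have S1y y : S 1 y = 1 by rewrite S1.
have SiM g y : S (iX * g) y = S iX y * S g y.
  have [phi [phiZ phiE]] := mul_real_linear_in_image iX y.
  rewrite phiE mulrC; apply: (real_linear_complexE phi _ _ _ phiZ (image_of_i y)).
  - exact: raddfD.
  - by rewrite -(S1y y) -phiE mulr1.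
  - rewrite -phiE mul_iX raddfN S1 -[LHS]/(- (1 : R[i])) -sqr_i -expr2.
    by case: (image_of_i y) => ->; rewrite ?sqrrN.
move=> f g; apply: contC_eqP => y.
have [phi [phiZ phiE]] := mul_real_linear_in_image f y.
rewrite phiE -[RHS]/(S f y * S g y) mulrC.
apply: (real_linear_complexE phi _ _ _ phiZ (image_of_i y)).
- exact: raddfD.
- by rewrite -(S1y y) -phiE mulr1.
- by rewrite -phiE mulrC SiM.
Qed.

End Multiplicative.

(** * Involution-preserving ring morphisms are compositions *)

Section StarHomomorphism.
Context {R : realType}.
Local Notation Re := (@complex.Re R).
Local Notation Im := (@complex.Im R).

(** Nonnegative reals are squares, so the morphism is monotone, and it fixes the
rationals, which are dense. *)
Lemma real_rmorph_id (phi : {rmorphism R -> R}) r : phi r = r.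
Proof.
have phi0 s : 0 <= s -> 0 <= phi s.
  by move=> /sqr_sqrtr <-; rewrite rmorphXn sqr_ge0.
have phile s t : s <= t -> phi s <= phi t.
  by rewrite -subr_ge0 => /phi0; rewrite rmorphB subr_ge0.
apply/eqP; rewrite eq_le; apply/andP; split; rewrite leNgt; apply/negP.
- move=> /rat_in_itvoo[q]; rewrite in_itv /= => /andP[rq].
  by rewrite -(fmorph_rat phi q) ltNge phile// ltW.
- move=> /rat_in_itvoo[q]; rewrite in_itv /= => /andP[+ qr].
  by rewrite -(fmorph_rat phi q) ltNge phile// ltW.
Qed.

(** Commuting with conjugation keeps the reals inside the reals; this excludes the
wild endomorphisms of the complex field. *)
Lemma conj_rmorph_id_or_conj (chi : {rmorphism R[i] -> R[i]}) :
  (forall z, chi (conjc z) = conjc (chi z)) ->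
  (chi 'i = 'i /\ chi =1 id) \/ (chi 'i = - 'i /\ chi =1 conjc).
Proof.
move=> chiJ; pose phi r := Re (chi r%:C).
have chir r : chi r%:C = (phi r)%:C.
  have := chiJ r%:C; rewrite conjc_real /phi; case: (chi _) => a b [] b0.
  by congr Complex; lra.
have phiB : zmod_morphism phi.
  by move=> r s; apply: (@complexI R); rewrite -chir !rmorphB /= !chir.
have phiM : monoid_morphism phi.
  split; first by rewrite /phi rmorph1.
  by move=> r s; apply: (@complexI R); rewrite -chir !rmorphM /= !chir.
pose phiR : {rmorphism R -> R} := HB.pack phi
  (GRing.isZmodMorphism.Build _ _ phi phiB)
  (GRing.isMonoidMorphism.Build _ _ phi phiM).
have {}chir r : chi r%:C = r%:C by rewrite chir (real_rmorph_id phiR r : phi r = r).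
have chiE z : chi z = (Re z)%:C + chi 'i * (Im z)%:C.
  by rewrite {1}(complexE z) rmorphD rmorphM /= !chir.
have : chi 'i ^+ 2 = 'i ^+ 2 by rewrite -rmorphXn sqr_i rmorphN1.
move=> /eqP; rewrite eqf_sqr => /orP[] /eqP ii; [left|right]; split=> // z.
  by rewrite chiE ii -complexE.
rewrite chiE ii mulNr; case: z => a b /=.
by apply/eqP; rewrite eq_complex /= !mul0r !mul1r !(subr0, addr0, add0r, oppr0) !eqxx.
Qed.

Lemma closed_fiber (X : topologicalType) (f : contC R X) (z : R[i]) :
  closed [set x | f x = z].
Proof.
have cz : closed [set z : (R[i] : numFieldType)].
  apply: accessible_closed_set1; apply: hausdorff_accessible.
  exact: (@norm_hausdorff _ (R[i] : numFieldType)).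
by apply: (closed_comp _ cz) => x _; exact: (@cts_fun _ _ f x).
Qed.

Lemma open_nonzero (X : topologicalType) (f : contC R X) :
  open [set x | f x != 0].
Proof.
have := closed_openC (closed_fiber _ f 0); congr open.
by apply/seteqP; split=> x /= /eqP.
Qed.

Lemma contC_separation (X : topologicalType) (cX : compact [set: X])
    (hX : hausdorff_space X) (x : X) (B : set X) :
  closed B -> ~ B x -> exists f : contC R X, f x != 0 /\ forall z, B z -> f z = 0.
Proof.
move=> cB Bx.
have cx : closed [set x].
  exact: accessible_closed_set1 (hausdorff_accessible hX) _.
have Bx0 : B `&` [set x] = set0.
  by rewrite -subset0 => z [Bz zx]; apply: Bx; rewrite -zx.
have := (normal_separatorP (R := R)).1 (compact_normal hX cX) _ _ cB cx Bx0.
move=> /(uniform_separatorP (R := R))[f [cf _ fB fx]].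
have cfC : continuous ((fun z => (f z)%:C) : X -> (R[i] : numFieldType)).
  move=> z; apply: (@continuous_comp _ _ _ f (fun r : R => r%:C : (R[i] : numFieldType))).
    exact: cf.
  exact: continuous_real_complex.
exists (mkcts cfC : contC R X); split=> [|z Bz] /=.
  have -> : (mkcts cfC : contC R X) x = (f x)%:C by [].
  by rewrite (fx (f x)) ?oner_eq0//; exists x.
have -> : (mkcts cfC : contC R X) z = (f z)%:C by [].
by rewrite (fB (f z))//; exists z.
Qed.

Lemma contC_inverse (X : topologicalType) (h : contC R X) :
  (forall x, h x != 0) -> exists k, k * h = 1.
Proof.
move=> h0.
have ck : continuous ((fun x => (h x)^-1) : X -> (R[i] : numFieldType)).
  by move=> x; apply: (@cvgV (R[i] : numFieldType)) => //; exact: (@cts_fun _ _ h x).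
exists (mkcts ck : contC R X); apply: contC_eqP => x.
by rewrite -[LHS]/((h x)^-1 * h x) mulVf.
Qed.

(** The zero sets of the elements of [I] are closed, nonempty (a function without
zeros is invertible) and stable under intersection, since [|f|^2 + |g|^2] is in
[I]; a cluster point of the filter they generate is a common zero. *)
Lemma ideal_common_zero (X : topologicalType) (cX : compact [set: X])
    (I : contC R X -> Prop) :
  I 0 -> (forall f g, I f -> I g -> I (f + g)) ->
  (forall f g, I g -> I (f * g)) -> ~ I 1 ->
  exists x, forall f, I f -> f x = 0.
Proof.
move=> I0 ID IM I1; pose Z (f : contC R X) := [set x | f x = 0].
have Z0 f : I f -> Z f !=set0.
  move=> If; apply: contrapT => /forallNP nz; apply: I1.
  have [|k <-] := contC_inverse X f; last exact: IM.
  by move=> x; apply/eqP; exact: nz.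
have FF : ProperFilter (filter_from I Z).
  apply: filter_from_proper => //; apply: filter_from_filter; first by exists 0.
  move=> f g If Ig; exists (contC_conj f * f + contC_conj g * g).
    by apply: ID; exact: IM.
  move=> x; rewrite /Z /= -[LHS]/(conjc (f x) * f x + conjc (g x) * g x).
  move=> /eqP; rewrite paddr_eq0; try by rewrite mulrC mulcJ_ge0.
  by rewrite !mulf_eq0 !conjc_eq0 !orbb => /andP[/eqP ? /eqP].
have [|x [_ Fx]] := cX _ FF; first exact: filterT.
exists x => f If; apply: (closed_fiber X f 0) => U xU.
by apply: Fx => //; exists f.
Qed.

(** The functions whose image vanishes at [y] form a proper ideal, so they all
vanish at some point [x].  Since [S] at [y] maps constants onto the complex
numbers, subtracting from [f] the constant with the same image shows that the
image of [f] is that of the constant [f x]. *)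
Lemma star_rmorphism_point (X Y : topologicalType) (cX : compact [set: X])
    (S : {rmorphism contC R X -> contC R Y}) :
  (forall f, S (contC_conj f) = contC_conj (S f)) ->
  forall y, exists x,
    (S (contC_const 'i) y = 'i /\ forall f, S f y = f x) \/
    (S (contC_const 'i) y = - 'i /\ forall f, S f y = conjc (f x)).
Proof.
move=> Sconj y.
pose chi z := S (contC_const z) y.
have chiB : zmod_morphism chi.
  by move=> z w; rewrite /chi (_ : contC_const (z - w) = contC_const z - contC_const w)
    ?rmorphB//; apply: contC_eqP.
have chiM : monoid_morphism chi.
  split; first by rewrite /chi (_ : contC_const 1 = 1) ?rmorph1//; apply: contC_eqP.
  by move=> z w; rewrite /chi (_ : contC_const (z * w) = contC_const z * contC_const w)
    ?rmorphM//; apply: contC_eqP.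
pose chiR : {rmorphism R[i] -> R[i]} := HB.pack chi
  (GRing.isZmodMorphism.Build _ _ chi chiB)
  (GRing.isMonoidMorphism.Build _ _ chi chiM).
have chiJ z : chi (conjc z) = conjc (chi z).
  rewrite -[RHS]/(contC_conj (S (contC_const z)) y) -Sconj /chi.
  by congr (S _ y); apply: contC_eqP.
have [x zx] : exists x, forall f, S f y = 0 -> f x = 0.
  apply: (@ideal_common_zero _ cX (fun f => S f y = 0)).
  - by rewrite rmorph0.
  - by move=> f g Sf Sg; rewrite rmorphD -[LHS]/(S f y + S g y) Sf Sg addr0.
  - by move=> f g Sg; rewrite rmorphM -[LHS]/(S f y * S g y) Sg mulr0.
  - by rewrite rmorph1 => /eqP; rewrite -[_ == _]/((1 : R[i]) == 0) oner_eq0.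
have fx f c : S f y = chi c -> f x = c.
  move=> Sfc; apply/eqP; rewrite -subr_eq0; apply/eqP.
  apply: (zx (f - contC_const c)).
  by rewrite rmorphB -[LHS]/(S f y - chi c) Sfc subrr.
exists x; case: (conj_rmorph_id_or_conj chiR chiJ) => -[chii chiE]; [left|right].
- by split=> // f; rewrite (fx f (S f y))// -[RHS]/(chiR (S f y)) chiE.
- split=> // f; rewrite (fx f (conjc (S f y))) ?conjcK//.
  by rewrite -[RHS]/(chiR (conjc (S f y))) chiE conjcK.
Qed.

(** The zeros of [S f] are the preimages by [tau] of those of [f], so functions
vanishing off a neighbourhood of [tau y] give continuity at [y]. *)
Lemma star_rmorphism_map (X Y : topologicalType) (cX : compact [set: X])
    (hX : hausdorff_space X) (S : {rmorphism contC R X -> contC R Y}) :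
  (forall f, S (contC_conj f) = contC_conj (S f)) ->
  exists2 tau : Y -> X, continuous tau & forall y,
    (S (contC_const 'i) y = 'i /\ forall f, S f y = f (tau y)) \/
    (S (contC_const 'i) y = - 'i /\ forall f, S f y = conjc (f (tau y))).
Proof.
move=> /(star_rmorphism_point _ _ cX) /choice[tau tauE]; exists tau => //.
have S0 f y : S f y = 0 <-> f (tau y) = 0.
  case: (tauE y) => -[_ ->] //; split=> /eqP; first by rewrite conjc_eq0 => /eqP.
  by move=> /eqP ->; exact: conjc0.
move=> y U /= ; rewrite nbhsE => -[V [oV Vy] VU].
have [] := contC_separation X cX hX (tau y) (~` V); [exact: open_closedC|by []|].
move=> f [fy fV].
have : nbhs y [set z | S f z != 0].
  apply: open_nbhs_nbhs; split; first exact: open_nonzero.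
  by apply/eqP => /S0 /eqP; exact/negP.
apply: filterS => z /eqP Sfz; apply: VU; apply: contrapT => Vz.
by apply: Sfz; apply/S0; exact: fV.
Qed.

End StarHomomorphism.

(** * Isomorphisms and the sign *)

Lemma contC_zeros_inj {R : realType} (X : topologicalType) (cX : compact [set: X])
    (hX : hausdorff_space X) x z :
  (forall f : contC R X, f x = 0 -> f z = 0) -> z = x.
Proof.
move=> fxz; apply: contrapT => zx.
have [||f [/eqP fz fx]] := contC_separation (R := R) X cX hX z [set x].
- exact: accessible_closed_set1 (hausdorff_accessible hX) _.
- by [].
- by apply: fz; apply: fxz; exact: fx.
Qed.

Section Unimodular.
Context {R : realType} {X Y : topologicalType}.
Local Notation normc := (@Normc.normc R).

(** Domination of [e] by [1] and of [1] by [e]. *)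
Lemma norm_preserving_multiplier (cY : compact [set: Y]) (e : contC R Y) :
  (forall h, supnorm (e * h) = supnorm h) -> forall y, normc (e y) = 1.
Proof.
move=> eh y; have n1 : normc ((1 : contC R Y) y) = 1 by exact: Normc.normc1.
apply/eqP; rewrite eq_le; apply/andP; split.
- rewrite -[leRHS](mul1r 1) -[X in _ <= _ * X]n1.
  by apply: supnorm_mul_dominates => // h; rewrite eh !mul1r.
- rewrite -[leRHS]mul1r -[X in X <= _]n1.
  by apply: supnorm_mul_dominates => // h; rewrite eh !mul1r.
Qed.

Lemma real_normc1 (z : R[i]) : conjc z = z -> normc z = 1 -> z = 1 \/ z = -1.
Proof.
case: z => a b [] bN /=; have -> : b = 0 by lra.
rewrite expr0n addr0 sqrtr_sqr => /eqP; rewrite eqr_norml ler01 andbT.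
move=> /orP[] /eqP ->; [left|right] => //.
by rewrite -[RHS]/(Complex (- 1) (- 0)) oppr0.
Qed.

(** The map obtained from the inverse of [S] is inverse to [tau] because both
composites preserve zeros of functions, and functions separate points. *)
Lemma star_isomorphism_homeomorphism (cX : compact [set: X])
    (hX : hausdorff_space X) (cY : compact [set: Y]) (hY : hausdorff_space Y)
    (S : {rmorphism contC R X -> contC R Y}) (S' : contC R Y -> contC R X) :
  cancel S S' -> cancel S' S ->
  (forall f, S (contC_conj f) = contC_conj (S f)) ->
  exists2 tau : Y -> X, homeomorphism tau & forall y,
    (S (contC_const 'i) y = 'i /\ forall f, S f y = f (tau y)) \/
    (S (contC_const 'i) y = - 'i /\ forall f, S f y = conjc (f (tau y))).
Proof.
move=> SK S'K Sconj; have Sinj := can_inj SK.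
have S'B : zmod_morphism S'.
  by move=> f g; apply: Sinj; rewrite rmorphB !S'K.
have S'M : monoid_morphism S'.
  split; first by apply: Sinj; rewrite S'K rmorph1.
  by move=> f g; apply: Sinj; rewrite rmorphM !S'K.
pose S'R : {rmorphism contC R Y -> contC R X} := HB.pack S'
  (GRing.isZmodMorphism.Build _ _ S' S'B)
  (GRing.isMonoidMorphism.Build _ _ S' S'M).
have S'conj f : S'R (contC_conj f) = contC_conj (S'R f).
  by apply: Sinj; rewrite Sconj /= !S'K.
have [tau ctau tauE] := star_rmorphism_map X Y cX hX S Sconj.
have [sigma csigma sigmaE] := star_rmorphism_map Y X cY hY S'R S'conj.
have S0 f y : S f y = 0 -> f (tau y) = 0.
  by case: (tauE y) => -[_ ->] // /(congr1 conjc); rewrite conjcK conjc0.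
have S'0 g x : S'R g x = 0 -> g (sigma x) = 0.
  by case: (sigmaE x) => -[_ ->] // /(congr1 conjc); rewrite conjcK conjc0.
exists tau => //; split=> //; exists sigma; split=> // [y|x].
- by apply: (contC_zeros_inj Y cY hY) => g gy; apply: S'0; apply: S0; rewrite S'K.
- by apply: (contC_zeros_inj X cX hX) => f fx; apply: S0; apply: S'0; rewrite /= SK.
Qed.

End Unimodular.

Theorem mainTheorem1 (R : realType) (X Y : topologicalType)
    (cX : compact [set: X]) (hX : hausdorff_space X)
    (cY : compact [set: Y]) (hY : hausdorff_space Y)
    (T : contC R X -> contC R Y)
    (Tbij : bijective T)
    (Tadd : forall f g : contC R X, supnorm (T (f + g)) = supnorm (T f + T g))
    (Tmul : forall f g : contC R X, supnorm (T (f * g)) = supnorm (T f * T g))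
    (Tconj : forall f : contC R X, T (contC_conj f) = contC_conj (T f)) :
  exists (u : continuousType Y R) (tau : Y -> X) (K : set Y),
    [/\ forall y, u y = 1 \/ u y = -1,
        homeomorphism tau,
        clopen K
      & forall (f : contC R X) (y : Y),
          (K y -> T f y = (u y)%:C * f (tau y)) /\
          (~ K y -> T f y = (u y)%:C * conjc (f (tau y)))].
Proof.
have TD : {morph T : f g / f + g}.
  exact: norm_additive_additive (supnorm_doubling cY) Tbij Tadd.
have [T' TK T'K] := Tbij.
pose e := T 1.
have eh h : supnorm (e * h) = supnorm h by rewrite -(T'K h) -Tmul mul1r.
have eJ y : conjc (e y) = e y.
  rewrite -[LHS]/(contC_conj (T 1) y) -Tconj; congr (T _ y).
  by apply: contC_eqP => x; exact: conjc1.
have e1 y : e y = 1 \/ e y = -1.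
  by apply: real_normc1; [exact: eJ|exact: norm_preserving_multiplier].
have ee : e * e = 1.
  apply: contC_eqP => y; rewrite -[LHS]/(e y * e y) -[RHS]/(1 : R[i]).
  by case: (e1 y) => ->; rewrite ?mulrNN mulr1.
have eK h : e * (e * h) = h by rewrite mulrA ee mul1r.
pose S f := e * T f; pose S' g := T' (e * g).
have SK : cancel S S' by move=> f; rewrite /S' /S eK TK.
have S'K : cancel S' S by move=> g; rewrite /S' /S T'K eK.
have SB : zmod_morphism S.
  move=> f g; rewrite /S -mulrBr; congr (e * _).
  by apply/eqP; rewrite eq_sym subr_eq -TD subrK.
pose SA : {additive contC R X -> contC R Y} :=
  HB.pack S (GRing.isZmodMorphism.Build _ _ S SB).
have Sconj f : S (contC_conj f) = contC_conj (S f).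
  rewrite /S Tconj; apply: contC_eqP => y.
  by rewrite -[LHS]/(e y * conjc (T f y)) -[RHS]/(conjc (e y * T f y)) rmorphM/= eJ.
have SM : monoid_morphism S.
  split=> //; apply: (@supnorm_multiplicative_multiplicative _ _ _ cY SA S') => //.
  by move=> f g; rewrite /= /S eh Tmul mulrACA ee mul1r.
pose SR : {rmorphism contC R X -> contC R Y} := HB.pack S
  (GRing.isZmodMorphism.Build _ _ S SB) (GRing.isMonoidMorphism.Build _ _ S SM).
have [tau htau tauE] :=
  star_isomorphism_homeomorphism cX hX cY hY SR S' SK S'K Sconj.
have cu : continuous (fun y => complex.Re (e y) : R).
  move=> y; apply: (@continuous_comp _ _ _ e
    (@complex.Re R : (R[i] : numFieldType) -> R)).
    exact: (@cts_fun _ _ e y).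
  apply: continuous_complex_lipschitz => z w.
  by apply: le_trans (ler_norm_Re (z - w)); case: z w => [? ?] [? ?].
have eu y : e y = (complex.Re (e y))%:C by case: (e1 y) => ->; rewrite //= ?rmorphN1.
exists (mkcts cu : continuousType Y R), tau, [set y | S (contC_const 'i) y = 'i].
have TE f y : T f y = (complex.Re (e y))%:C * S f y.
  by rewrite -eu -[RHS]/((e * (e * T f)) y) eK.
have ni : - 'i <> 'i :> R[i] by move=> [_]; lra.
split=> //.
- move=> y; change (complex.Re (e y) = 1 \/ complex.Re (e y) = -1).
  by case: (e1 y) => ->; [left|right].
- split; last exact: closed_fiber.
  (* The complement of the set is the fibre of the same function at [- 'i]. *)
  have := closed_openC (closed_fiber Y (SR (contC_const 'i)) (- 'i)); congr open.
  apply/seteqP; split=> y /=.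
    by case: (tauE y) => -[].
  by move=> -> /esym.
- move=> f y; split=> /= Ky; rewrite TE; congr (_ * _).
    by case: (tauE y) => -[]; rewrite /= Ky // => /esym.
  by case: (tauE y) => -[]; rewrite /=.
Qed.
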